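(* Let $X$ be an infinite set and let $G$ be a group with $\mathrm{FAlt}(X)\leqslant G\leqslant \mathrm{Sym}(X)$. Then $\mathrm{FAlt}(X)$ is a characteristic subgroup of $G$, $\mathrm{Aut}(G)\cong N_{\mathrm{Sym}(X)}(G)$, and $G$ is monolithic. Moreover, every automorphism $\phi\in\mathrm{Aut}(G)$ preserves the cycle type of elements of $G$ (that is, for every $g\in G$ the permutations $g$ and $(g)\phi$ of $X$ have the same cycle type), and hence, if $\mathrm{FSym}(X)\leqslant G$, then $\mathrm{FSym}(X)$ is a characteristic subgroup of $G$.
   Context: For a set $X$, $\mathrm{Sym}(X)$ is the group of all permutations of $X$, $\mathrm{FSym}(X)$ is the subgroup of permutations with finite support, and $\mathrm{FAlt}(X)$ is the subgroup of even permutations with finite support. For $G\leqslant \mathrm{Sym}(X)$, $N_{\mathrm{Sym}(X)}(G):=\{\rho\in \mathrm{Sym}(X)\mid \rho^{-1}g\rho\in G \text{ for every } g\in G\}$. Maps are written on the right. A group is monolithic if it has a non-trivial normal subgroup that is contained in every non-trivial normal subgroup. Two permutations of $X$ have the same cycle type if for each orbit size (finite, or infinite) they have the same cardinality of orbits of that size; equivalently, they are conjugate in $\mathrm{Sym}(X)$.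
   Formalization: The normaliser is taken as {ρ : ρ⁻¹Gρ = G}; the displayed condition ρ⁻¹gρ ∈ G for every g ∈ G alone need not define a group (G = ⟨FAlt(ℚ), x↦x+1⟩, ρ: x↦2x), and then Aut(G) ≅ N(G) fails. *)

(* Defs.v *)
From HB Require Import structures.
From mathcomp Require Import all_boot.
From mathcomp Require Import boolp classical_sets functions cardinality.

Set Implicit Arguments.
Unset Strict Implicit.
Unset Printing Implicit Defensive.

Local Open Scope group_scope.
Local Open Scope classical_set_scope.
Local Open Scope card_scope.

(* The inverse is stored as data so that the group structure needs no choice;
   it is determined by the function, see [Sym_ext]. *)
Record Sym (X : Type) := MkSym {
  sym_fun :> X -> X;
  sym_inv : X -> X;
  sym_funK : cancel sym_fun sym_inv;
  sym_invK : cancel sym_inv sym_fun }.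

Section SymGroup.
Variable X : Type.
Implicit Types f g h : Sym X.

Lemma Sym_ext f g : f =1 g -> f = g.
Proof.
case: f g => [f f' fK f'K] [g g' gK g'K] /= /funext fg; subst g.
have /funext e : f' =1 g' by move=> x; rewrite -{1}(g'K x) fK.
by subst g'; congr MkSym; exact: Prop_irrelevance.
Qed.

HB.instance Definition _ := gen_eqMixin (Sym X).
HB.instance Definition _ := gen_choiceMixin (Sym X).

Definition sym_one : Sym X := @MkSym X idfun idfun (frefl _) (frefl _).

(* Maps act on the right: [f * g] is first [f], then [g]. *)
Definition sym_mul f g : Sym X :=
  MkSym (can_comp (sym_funK g) (sym_funK f))
        (can_comp (sym_invK f) (sym_invK g)).

Definition sym_opp f : Sym X := MkSym (sym_invK f) (sym_funK f).

Fact sym_mulA : associative sym_mul. Proof. by move=> f g h; exact: Sym_ext. Qed.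
Fact sym_mul1g : left_id sym_one sym_mul. Proof. by move=> f; exact: Sym_ext. Qed.
Fact sym_mulg1 : right_id sym_one sym_mul. Proof. by move=> f; exact: Sym_ext. Qed.
Fact sym_mulVg : left_inverse sym_one sym_opp sym_mul.
Proof. by move=> f; apply: Sym_ext => x /=; rewrite sym_invK. Qed.
Fact sym_mulgV : right_inverse sym_one sym_opp sym_mul.
Proof. by move=> f; apply: Sym_ext => x /=; rewrite sym_funK. Qed.

HB.instance Definition _ := isGroup.Build (Sym X)
  sym_mulA sym_mul1g sym_mulg1 sym_mulVg sym_mulgV.

Lemma symM f g x : (f * g) x = g (f x). Proof. by []. Qed.
Lemma sym1 x : (1 : Sym X) x = x. Proof. by []. Qed.
Lemma symKV f x : f (f^-1 x) = x. Proof. exact: sym_invK. Qed.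
Lemma symVK f x : f^-1 (f x) = x. Proof. exact: sym_funK. Qed.

Definition sym_support f : set X := [set x | f x <> x].

Definition FSym : {pred Sym X} := [pred f : Sym X | `[< finite_set (sym_support f) >]].

Definition transposition f := exists a b : X,
  [/\ a <> b, f a = b, f b = a & forall x, x <> a -> x <> b -> f x = x].

Definition even f := exists s : seq (Sym X),
  [/\ forall t, t \in s -> transposition t, ~~ odd (size s) & f = \prod_(t <- s) t].

Definition FAlt : {pred Sym X} := [pred f : Sym X | (f \in FSym) && `[< even f >]].

Fact FSym1 : 1 \in FSym.
Proof.
apply/asboolP; apply: (sub_finite_set _ (finite_set0 X)).
by move=> x /(_ erefl).
Qed.

Fact FSymM : mulg_closed FSym.
Proof.
move=> f g /asboolP ff /asboolP fg; apply/asboolP.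
apply: (@sub_finite_set _ _ (sym_support f `|` sym_support g)); last by rewrite finite_setU.
move=> x; rewrite /sym_support /= => ne.
by have [fx|] := pselect (f x = x); [right; rewrite -{1}fx | left].
Qed.

Fact FSymV : invg_closed FSym.
Proof.
move=> f /asboolP ff; apply/asboolP; apply: sub_finite_set ff => x.
by rewrite /sym_support /= => ne fx; apply: ne; rewrite -{1}fx sym_funK.
Qed.

HB.instance Definition _ := isMulClosed.Build (Sym X) FSym FSymM.
HB.instance Definition _ := isMul1Closed.Build (Sym X) FSym FSym1.
HB.instance Definition _ := isInvClosed.Build (Sym X) FSym FSymV.

Lemma transpositionV f : transposition f -> transposition f^-1.
Proof.
move=> [a [b [ab fa fb fx]]]; exists a, b; split=> //.
- by rewrite -{1}fb symVK.
- by rewrite -{1}fa symVK.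
- by move=> x xa xb; rewrite -{1}(fx x xa xb) symVK.
Qed.

Fact FAlt1 : 1 \in FAlt.
Proof.
apply/andP; split; first exact: FSym1.
by apply/asboolP; exists [::]; split=> //; rewrite big_nil.
Qed.

Fact FAltM : mulg_closed FAlt.
Proof.
move=> f g /andP[ff /asboolP[s [st so fE]]] /andP[fg /asboolP[r [rt ro gE]]].
apply/andP; split; first exact: FSymM.
apply/asboolP; exists (s ++ r); split.
- by move=> t; rewrite mem_cat => /orP[/st|/rt].
- by rewrite size_cat oddD (negbTE so) (negbTE ro).
- by rewrite big_cat fE gE.
Qed.

Fact FAltV : invg_closed FAlt.
Proof.
move=> f /andP[ff /asboolP[s [st so fE]]].
apply/andP; split; first exact: FSymV.
apply/asboolP; exists (rev [seq t^-1 | t <- s]); split.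
- move=> t; rewrite mem_rev => /mapP[u us ->]; exact/transpositionV/st.
- by rewrite size_rev size_map.
- rewrite {}fE {ff st so}; elim: s => [|t s IHs]; first by rewrite !big_nil invg1.
  by rewrite big_cons invgM IHs /= rev_cons -cats1 big_cat big_seq1.
Qed.

HB.instance Definition _ := isMulClosed.Build (Sym X) FAlt FAltM.
HB.instance Definition _ := isMul1Closed.Build (Sym X) FAlt FAlt1.
HB.instance Definition _ := isInvClosed.Build (Sym X) FAlt FAltV.

Definition sym_orbit f (x : X) : set X :=
  [set y | exists n : nat, (f ^+ n) x = y \/ (f ^- n) x = y].

Definition sym_orbits f : set (set X) := range (sym_orbit f).

(* Orbit sizes are cardinals at most that of [X], hence the cardinals of the
   subsets [S] of [X]. *)
Definition same_cycle_type f g := forall S : set X,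
  [set O | sym_orbits f O /\ O #= S] #= [set O | sym_orbits g O /\ O #= S].

End SymGroup.

Arguments FSym X : clear implicits.
Arguments FAlt X : clear implicits.

(* A subgroup, as a group in its own right. *)
Record subg (gT : groupType) (G : groupClosed gT) := Subg {
  subg_val :> gT;
  subg_valP : subg_val \in G }.

Section Subgroups.
Variable gT : groupType.
Implicit Types G H : groupClosed gT.

HB.instance Definition _ G := [isSub for @subg_val gT G].
HB.instance Definition _ G := [Choice of subg G by <:].

Fact subg_closed G : group_closed (fun x => x \in G).
Proof. by split=> [|x y xG yG]; [exact: gpred1 | exact: gpredF]. Qed.

HB.instance Definition _ G :=
  SubChoice_isSubGroup.Build gT (fun x => x \in G) (subg G) (subg_closed G).

(* [H] seen inside [G]: the subgroup [G `&` H] of [subg G]. *)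
Definition insubg H G : {pred subg G} := [pred x : subg G | subg_val x \in H].
Arguments insubg H G : clear implicits.

Fact insubg1 H G : 1 \in insubg H G. Proof. by rewrite inE /=; exact: gpred1. Qed.
Fact insubgM H G : mulg_closed (insubg H G).
Proof. by move=> x y; rewrite !inE /=; exact: gpredM. Qed.
Fact insubgV H G : invg_closed (insubg H G).
Proof. by move=> x; rewrite !inE /=; exact: gpredVr. Qed.

HB.instance Definition _ H G := isMulClosed.Build (subg G) (insubg H G) (@insubgM H G).
HB.instance Definition _ H G := isMul1Closed.Build (subg G) (insubg H G) (insubg1 H G).
HB.instance Definition _ H G := isInvClosed.Build (subg G) (insubg H G) (@insubgV H G).

(* The elements [r] with [r^-1 G r = G]. When [G] is infinite, asking only for
   [r^-1 G r] to be contained in [G] need not define a group: for [G] generated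
   by [x |-> x + 1] in the permutations of the rationals, [x |-> 2 x] meets the
   weaker condition but its inverse does not. *)
Definition normaliser G : {pred gT} :=
  [pred r : gT | `[< [set g ^ r | g in [set` G]] = [set` G] >]].

Fact normaliserP G r :
  reflect (forall g, (g ^ r \in G) = (g \in G)) (r \in normaliser G).
Proof.
apply: (iffP (asboolP _)) => [Gr g|Gr].
  apply/idP/idP => [|gG].
    have /= <- := congr1 (fun A : set gT => A (g ^ r)) Gr.
    by case=> h hG /conjg_inj <-.
  by have /= := congr1 (fun A : set gT => A (g ^ r)) Gr => <-; exists g.
apply/seteqP; split=> [_ [g gG <-]|g gG] /=; first by rewrite Gr.
by exists (g ^ r^-1); rewrite /= ?conjgKV // -Gr conjgKV.
Qed.

Fact normaliser1 G : 1 \in normaliser G.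
Proof. by apply/normaliserP => g; rewrite conjg1. Qed.
Fact normaliserM G : mulg_closed (normaliser G).
Proof.
by move=> r s /normaliserP rG /normaliserP sG; apply/normaliserP => g; rewrite conjgM sG rG.
Qed.
Fact normaliserV G : invg_closed (normaliser G).
Proof. by move=> r /normaliserP rG; apply/normaliserP => g; rewrite -[LHS]rG conjgKV. Qed.

HB.instance Definition _ G := isMulClosed.Build gT (normaliser G) (@normaliserM G).
HB.instance Definition _ G := isMul1Closed.Build gT (normaliser G) (normaliser1 G).
HB.instance Definition _ G := isInvClosed.Build gT (normaliser G) (@normaliserV G).

Definition multiplicative_pred : {pred Sym gT} :=
  [pred f : Sym gT | `[< {morph f : x y / x * y} >]].

Fact multiplicative_pred1 : 1 \in multiplicative_pred.
Proof. exact/asboolP. Qed.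
Fact multiplicative_predM : mulg_closed multiplicative_pred.
Proof.
move=> f g /asboolP fM /asboolP gM; apply/asboolP => x y.
by rewrite !symM fM gM.
Qed.
Fact multiplicative_predV : invg_closed multiplicative_pred.
Proof.
move=> f /asboolP fM; apply/asboolP => x y.
by rewrite -{1}(symKV f x) -{1}(symKV f y) -fM symVK.
Qed.

HB.instance Definition _ :=
  isMulClosed.Build (Sym gT) multiplicative_pred multiplicative_predM.
HB.instance Definition _ :=
  isMul1Closed.Build (Sym gT) multiplicative_pred multiplicative_pred1.
HB.instance Definition _ :=
  isInvClosed.Build (Sym gT) multiplicative_pred multiplicative_predV.

End Subgroups.

Arguments insubg {gT} H G.

Section Groups.
Variable gT : groupType.
Implicit Type H : groupClosed gT.

(* The automorphism group, as a subgroup of the symmetric group on the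
   underlying set. *)
Definition Aut : groupType := subg (@multiplicative_pred gT).

Definition characteristic H :=
  forall phi : Aut, subg_val phi @` [set` H] = [set` H].

Definition normal H := forall x g : gT, x \in H -> x ^ g \in H.

Definition nontrivial H := exists2 x : gT, x \in H & x != 1.

Definition monolithic := exists M : groupClosed gT,
  [/\ normal M, nontrivial M &
      forall N : groupClosed gT, normal N -> nontrivial N -> {subset M <= N}].

End Groups.

Definition isomorphic (gT hT : groupType) :=
  exists2 f : gT -> hT, bijective f & {morph f : x y / x * y}.

(* Main.v *)
Require Import Defs.
From HB Require Import structures.
From mathcomp Require Import all_boot.
From mathcomp Require Import boolp classical_sets functions cardinality.

(** The subgroup FAlt(X) is so close to simple that it lies in every non-trivial normal
subgroup of G, and rich enough to recover the points of X; together these two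
facts force every automorphism of G to be conjugation by a permutation of X.

Monolith.  Let N be a non-trivial subgroup normalised by FAlt(X).  For n in N
and a 3-cycle t the commutator of n and t lies in N and has finite support.
So N has a non-trivial finitary element k, and if k moves a to b and fixes d
and e, then the commutator of k with the 3-cycle (b d e) is again a 3-cycle.
As FAlt(X) acts transitively on n-tuples of distinct points for each n, all
3-cycles are in N, hence so is FAlt(X) ([normal_ge_FAlt]).  A least non-trivial
normal subgroup is characteristic ([least_normal_characteristic]).

Recognising 3-cycles.  Two 3-cycles t and s move at most six points in all, so
(t s)^60 = 1.  An element t of order 3 in FAlt(X) with at least two non-trivial
orbits has a conjugate s such that t s has an orbit of size 7, and then
(t s)^60 differs from 1.  So the 3-cycles are the t <> 1 in FAlt(X) with
t^3 = 1 and (t t^g)^60 = 1 for all g ([three_cycle_of_exp60]), and each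
automorphism phi of G permutes them ([aut_three_cycle]).

Recovering points.  Distinct 3-cycles t and s agree at a point they move
exactly when t s is an involution ([share_edgeP]).  Fix a and b.  The 3-cycles
(a b x) pairwise share the directed edge from a to b, and it follows that all
phi (a b x) share one edge, from a' to b' ([common_edge], [aut_edge]).  Writing
phi (a b x) = (a' b' r(x)), with r(a) = a' and r(b) = b', defines a
permutation r of X such that phi is conjugation by r on the 3-cycles (a b x),
which generate FAlt(X) ([aut_agree_FAlt]).

From FAlt(X) to G.  For g in G both phi(g) and g^r act by conjugation on
FAlt(X) in the same way, and FAlt(X) has trivial centraliser, so they are equal
([aut_conj]).  The rest follows: r is unique and normalises G, which gives
Aut(G), and conjugation preserves both cycle type and finiteness of the
support. *)

Set Implicit Arguments.
Unset Strict Implicit.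
Unset Printing Implicit Defensive.

Local Open Scope group_scope.

(** * Transpositions, 3-cycles and finitary even permutations *)

Section Cycles.
Variable X : eqType.
Implicit Types (a b c d e x y z : X) (f g t s : Sym X) (u v l : seq X).

Definition swap_fun a b x := if x == a then b else if x == b then a else x.

Fact swap_funK a b : involutive (swap_fun a b).
Proof.
move=> x; rewrite /swap_fun.
case: (eqVneq x a) => [->|xa]; first by rewrite eqxx; case: eqVneq.
by case: (eqVneq x b) => [->|xb]; rewrite ?eqxx // (negbTE xa) (negbTE xb).
Qed.

Definition swap a b : Sym X := MkSym (swap_funK a b) (swap_funK a b).

Lemma swapE a b x : swap a b x = if x == a then b else if x == b then a else x.
Proof. by []. Qed.

Lemma swapC a b : swap a b = swap b a.
Proof.
apply: Sym_ext => x; rewrite !swapE.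
by case: (eqVneq x a) => [->|]; case: eqVneq.
Qed.

Lemma swapK a b : swap a b * swap a b = 1.
Proof. by apply: Sym_ext => x; rewrite symM; exact: swap_funK. Qed.

Lemma transpositionP f :
  transposition f <-> exists a b, a != b /\ f = swap a b.
Proof.
split=> [[a [b [/eqP ab fa fb fx]]]|[a [b [ab ->]]]].
  exists a, b; split=> //; apply: Sym_ext => x; rewrite swapE.
  by case: eqVneq => [->//|/eqP xa]; case: eqVneq => [->//|/eqP xb]; exact: fx.
exists a, b; rewrite !swapE !eqxx; split=> //; first exact/eqP.
  by case: eqVneq => // ->.
by move=> x /eqP/negbTE xa /eqP/negbTE xb; rewrite swapE xa xb.
Qed.

Lemma swap_transposition a b : a != b -> transposition (swap a b).
Proof. by move=> ab; apply/transpositionP; exists a, b. Qed.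

Lemma sym_inj f : injective f.
Proof. exact: can_inj (sym_funK f). Qed.

Lemma conj_symE f g x : (f ^ g) (g x) = g (f x).
Proof. by rewrite conjgE !symM symVK. Qed.

Lemma swapJ a b g : swap a b ^ g = swap (g a) (g b).
Proof.
apply: Sym_ext => x; rewrite -(symKV g x) conj_symE !swapE !(inj_eq (@sym_inj g)).
by case: eqP => // _; case: eqP.
Qed.

Lemma transpositionJ f g : transposition f -> transposition (f ^ g).
Proof.
move=> /transpositionP[a [b [ab ->]]]; rewrite swapJ.
by apply: swap_transposition; rewrite (inj_eq (@sym_inj g)).
Qed.

Lemma FSymP f : reflect (exists l, forall x, x \notin l -> f x = x) (f \in FSym X).
Proof.
apply: (iffP (asboolP _)) => [/finite_seqP[l fE]|[l fl]].
  exists l => x; apply: contraNeq => /eqP fx.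
  by have /= := congr1 (fun A : set X => A x) fE; rewrite /sym_support /= => <-.
apply: (@sub_finite_set _ _ [set` l]%classic); last exact: finite_seq.
move=> x /=; rewrite /sym_support /= => /eqP; apply: contraNT => xl.
exact/eqP/fl.
Qed.

Lemma transposition_FSym f : transposition f -> f \in FSym X.
Proof.
move=> /transpositionP[a [b [_ ->]]]; apply/FSymP; exists [:: a; b] => x.
by rewrite !inE negb_or swapE => /andP[/negbTE-> /negbTE->].
Qed.

Lemma FSymJ f g : f \in FSym X -> f ^ g \in FSym X.
Proof.
move=> /FSymP[l fl]; apply/FSymP; exists (map g l) => x.
rewrite -(symKV g x) (mem_map (@sym_inj g)) conj_symE => ?.
by rewrite fl.
Qed.

Definition transpositions (w : seq (Sym X)) := forall t, t \in w -> transposition t.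

Lemma FAltP f :
  reflect (exists w, [/\ transpositions w, ~~ odd (size w) & f = \prod_(t <- w) t])
          (f \in FAlt X).
Proof.
apply: (iffP andP) => [[_ /asboolP]//|[w [wt wo fE]]].
split; last by apply/asboolP; exists w.
rewrite fE big_seq; apply: gpred_prod => t /wt; exact: transposition_FSym.
Qed.

Lemma FAltJ f g : f \in FAlt X -> f ^ g \in FAlt X.
Proof.
move=> /FAltP[w [wt wo ->]]; apply/FAltP; exists [seq t ^ g | t <- w]; split.
- by move=> _ /mapP[t /wt tt ->]; exact: transpositionJ.
- by rewrite size_map.
- by rewrite conjg_prod big_map.
Qed.

Lemma uniq3E a b c : uniq [:: a; b; c] = [&& a != b, a != c & b != c].
Proof. by rewrite /= !inE negb_or andbT andbA. Qed.

(** For distinct points this is the 3-cycle a -> b -> c -> a. As a product of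
swaps it is a permutation for all arguments, and then conjugation and inversion
need no side condition. *)
Definition cyc a b c : Sym X := swap a b * swap a c.

Lemma cycE a b c x : uniq [:: a; b; c] ->
  cyc a b c x = if x == a then b else if x == b then c else if x == c then a else x.
Proof.
rewrite uniq3E => /and3P[ab ac bc].
rewrite /cyc symM !swapE; case: (eqVneq x a) => [_|xa].
  by rewrite eq_sym (negbTE ab) (negbTE bc).
case: (eqVneq x b) => [_|xb]; first by rewrite eqxx.
by rewrite (negbTE xa).
Qed.

Lemma cyc1 a b c : uniq [:: a; b; c] -> cyc a b c a = b.
Proof. by move=> /cycE->; rewrite eqxx. Qed.

Lemma cyc2 a b c : uniq [:: a; b; c] -> cyc a b c b = c.
Proof.
move=> abc; rewrite (cycE _ abc) eqxx; case: eqVneq => // ba.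
by move: abc; rewrite ba uniq3E eqxx.
Qed.

Lemma cyc3 a b c : uniq [:: a; b; c] -> cyc a b c c = a.
Proof.
move=> abc; rewrite (cycE _ abc) eqxx; move: abc; rewrite uniq3E.
by rewrite ![_ == c]eq_sym => /and3P[_ /negbTE-> /negbTE->].
Qed.

Lemma cyc_out a b c x : uniq [:: a; b; c] -> x \notin [:: a; b; c] -> cyc a b c x = x.
Proof.
by move=> /cycE->; rewrite !inE !negb_or => /and3P[/negbTE-> /negbTE-> /negbTE->].
Qed.

Lemma cyc_eq t a b c : uniq [:: a; b; c] -> t a = b -> t b = c -> t c = a ->
  (forall x, x \notin [:: a; b; c] -> t x = x) -> t = cyc a b c.
Proof.
move=> abc ta tb tc tx; apply: Sym_ext => x.
have [|xl] := boolP (x \in [:: a; b; c]); last by rewrite cyc_out ?tx.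
by rewrite !inE => /or3P[] /eqP->; rewrite ?cyc1 ?cyc2 ?cyc3.
Qed.

Lemma uniq3_rot a b c : uniq [:: a; b; c] = uniq [:: b; c; a].
Proof. by rewrite -(rot_uniq 1). Qed.

Lemma cyc_rot a b c : uniq [:: a; b; c] -> cyc a b c = cyc b c a.
Proof.
move=> abc; have bca : uniq [:: b; c; a] by rewrite -uniq3_rot.
apply: cyc_eq; rewrite ?cyc1 ?cyc2 ?cyc3 // => x xl.
by rewrite cyc_out // -(mem_rot 1).
Qed.

Lemma cycJ a b c g : cyc a b c ^ g = cyc (g a) (g b) (g c).
Proof. by rewrite conjMg !swapJ. Qed.

Lemma cycV a b c : (cyc a b c)^-1 = cyc a c b.
Proof. by rewrite /cyc invgM. Qed.

Lemma cyc_FAlt a b c : uniq [:: a; b; c] -> cyc a b c \in FAlt X.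
Proof.
rewrite uniq3E => /and3P[ab ac bc].
apply/FAltP; exists [:: swap a b; swap a c]; split=> //.
  2: by rewrite !big_cons big_nil mulg1.
by move=> t; rewrite !inE => /orP[] /eqP->; exact: swap_transposition.
Qed.

(** A product of two transpositions (a b)(c d) with b <> c is
(a b)(b c) . (b c)(c d), and each of the two factors is trivial or a 3-cycle. *)
Lemma FAlt_gen (K : groupClosed (Sym X)) :
  (forall a b c, uniq [:: a; b; c] -> cyc a b c \in K) -> {subset FAlt X <= K}.
Proof.
move=> Kcyc.
have Kcyc' a b c : b != a -> b != c -> swap b a * swap b c \in K.
  move=> ba bc; have [->|ac] := eqVneq a c; first by rewrite swapK gpred1.
  by apply: Kcyc; rewrite /= !inE negb_or ba bc ac.
have Kpair s t : transposition s -> transposition t -> s * t \in K.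
  move=> /transpositionP[a [b [ab ->]]] /transpositionP[c [d [cd ->]]].
  have [bc|bc] := eqVneq b c.
    by rewrite -bc in cd *; rewrite swapC; apply: Kcyc'; rewrite // eq_sym.
  have -> : swap a b * swap c d = (swap b a * swap b c) * (swap c b * swap c d).
    by rewrite -mulgA (mulgA (swap b c)) (swapC c b) swapK mul1g swapC.
  by apply: gpredM; apply: Kcyc'; rewrite // eq_sym.
move=> _ /FAltP[w [wt wo ->]].
have [n] := ubnP (size w); elim: n => // n IHn in w wt wo *.
case: w wt wo => [|s [|t w]] //=; first by rewrite big_nil gpred1.
move=> wt wo wn; rewrite !big_cons mulgA; apply: gpredM.
  by apply: Kpair; apply: wt; rewrite !inE eqxx ?orbT.
apply: IHn; [|by rewrite negbK in wo|by rewrite ltnW].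
by move=> r rw; apply: wt; rewrite !inE rw !orbT.
Qed.

Definition three_cycle t := exists a b c, uniq [:: a; b; c] /\ t = cyc a b c.

Lemma cyc_three_cycle a b c : uniq [:: a; b; c] -> three_cycle (cyc a b c).
Proof. by exists a, b, c. Qed.

Lemma three_cycle_FAlt t : three_cycle t -> t \in FAlt X.
Proof. by case=> a [b [c [abc ->]]]; exact: cyc_FAlt. Qed.

Lemma three_cycleJ t g : three_cycle t -> three_cycle (t ^ g).
Proof.
case=> a [b [c [abc ->]]]; exists (g a), (g b), (g c); rewrite cycJ; split=> //.
by rewrite (map_inj_uniq (@sym_inj g) [:: a; b; c]).
Qed.

Lemma three_cycle_at t a : three_cycle t -> t a != a ->
  uniq [:: a; t a; t (t a)] /\ t = cyc a (t a) (t (t a)).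
Proof.
case=> b [c [d [bcd tE]]].
have [] := boolP (a \in [:: b; c; d]); last by rewrite tE => /cyc_out->; rewrite ?eqxx.
have cdb : uniq [:: c; d; b] by rewrite -uniq3_rot.
have dbc : uniq [:: d; b; c] by rewrite -uniq3_rot.
rewrite !inE => /or3P[] /eqP-> _; rewrite tE !(cyc1 bcd, cyc2 bcd, cyc3 bcd).
- by [].
- by rewrite -(cyc_rot bcd).
- by rewrite -(cyc_rot cdb) -(cyc_rot bcd).
Qed.

Lemma three_cycleK t x : three_cycle t -> t (t (t x)) = x.
Proof.
move=> t3; have [tx|tx] := eqVneq (t x) x; first by rewrite !tx.
by have [/cyc3 tE tc] := three_cycle_at t3 tx; rewrite {1}tc.
Qed.

Lemma three_cycle_moved t a x : three_cycle t -> t a != a -> t x != x ->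
  x \in [:: a; t a; t (t a)].
Proof.
move=> t3 ta; have [u3 tE] := three_cycle_at t3 ta.
by apply: contraNT => xl; rewrite tE (cyc_out u3 xl).
Qed.

(** By induction: once the tail is in place, one more transposition corrects the
image of the head without disturbing the tail. *)
Lemma transpositions_transitive u v : uniq u -> uniq v -> size u = size v ->
  exists w, transpositions w /\ map (\prod_(t <- w) t) u = v.
Proof.
elim: u v => [|x u IHu] [|y v] //=; first by exists [::].
move=> /andP[xu uu] /andP[yv uv] [/(IHu _ uu uv) [w [wt wE]]].
set p := \prod_(t <- w) t in wE *.
have [pxy|pxy] := eqVneq (p x) y; first by exists w; rewrite wE -pxy.
exists (rcons w (swap (p x) y)); split.
  by move=> t; rewrite mem_rcons inE => /orP[/eqP->|/wt//]; exact: swap_transposition.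
rewrite big_rcons -/p symM swapE eqxx; congr cons.
rewrite -[RHS]wE; apply/eq_in_map => z zu; rewrite symM swapE.
rewrite (inj_eq (@sym_inj p)); case: eqVneq => [zx|_]; first by rewrite -zx zu in xu.
by case: eqVneq => // pz; rewrite -pz -wE (map_f p zu) in yv.
Qed.
End Cycles.

(** * Transitivity on tuples *)

Section Infinite.
Variable X : eqType.
Hypothesis infX : infinite_set [set: X]%classic.
Implicit Types (a b c d e x y z : X) (f g t s : Sym X) (u v l : seq X).

Lemma fresh l : exists x, x \notin l.
Proof.
apply/not_existsP => lX; apply: infX; apply/finite_seqP; exists l.
by apply/seteqP; split=> // x _ /=; apply/negPn/negP/lX.
Qed.

Lemma fresh_seq n l :
  exists v, [/\ uniq v, size v = n & {in v, forall x, x \notin l}].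
Proof.
elim: n => [|n [v [uv <- vl]]]; first by exists [::].
have [x] := fresh (v ++ l); rewrite mem_cat negb_or => /andP[xv xl].
exists (x :: v); split=> //=; first by rewrite xv.
by move=> y; rewrite inE => /orP[/eqP->|/vl].
Qed.

(** If the product obtained from [transpositions_transitive] is odd, it is made
even by a transposition of two points that do not occur in the target. *)
Lemma FAlt_transitive u v : uniq u -> uniq v -> size u = size v ->
  exists2 g, g \in FAlt X & map g u = v.
Proof.
move=> uu uv /(transpositions_transitive uu uv)[w [wt wE]].
have [wo|wo] := boolP (odd (size w)); last first.
  by exists (\prod_(t <- w) t) => //; apply/FAltP; exists w.
have [c cv] := fresh v; have [d] := fresh (c :: v).
rewrite inE negb_or => /andP[dc dv].
exists ((\prod_(t <- w) t) * swap c d).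
  apply/FAltP; exists (rcons w (swap c d)); split; last by rewrite big_rcons.
  - move=> t; rewrite mem_rcons inE => /orP[/eqP->|/wt//].
    by apply: swap_transposition; rewrite eq_sym.
  - by rewrite size_rcons /= wo.
rewrite -[RHS]wE; apply/eq_in_map => z zu; rewrite symM swapE.
have zv : (\prod_(t <- w) t) z \in v by rewrite -wE map_f.
case: eqVneq => [zc|_]; first by rewrite -zc zv in cv.
by case: eqVneq => [zd|//]; rewrite -zd zv in dv.
Qed.
End Infinite.

(** * Subgroups normalised by the finitary even permutations *)

Section Monolith.
Variable X : eqType.
Hypothesis infX : infinite_set [set: X]%classic.
Implicit Types (a b c d e x y z : X) (f g t s : Sym X) (u v l : seq X).

Lemma neq1_moves f : f != 1 -> exists a, f a != a.
Proof.
move=> f1; apply/not_existsP => fx; case/eqP: f1; apply: Sym_ext => x.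
exact/eqP/negPn/negP/fx.
Qed.

Lemma moves_neq1 f a : f a != a -> f != 1.
Proof. by apply: contraNneq => ->. Qed.

(** Commutators with 3-cycles first turn a non-trivial element of [K] into a
non-trivial finitary one, and then the latter into a 3-cycle; transitivity on
triples and [FAlt_gen] give the rest. *)
Lemma normal_ge_FAlt (K : groupClosed (Sym X)) :
  (forall f t, f \in K -> t \in FAlt X -> f ^ t \in K) ->
  (exists2 f, f \in K & f != 1) -> {subset FAlt X <= K}.
Proof.
move=> KJ [f fK f1].
have KR g t : g \in K -> t \in FAlt X -> g^-1 * g ^ t \in K.
  by move=> gK tA; rewrite gpredM ?gpredVr ?KJ.
have RE g t : g^-1 * g ^ t = t^-1 ^ g * t by rewrite !conjgE !mulgA.
have [k kK [kF k1]] : exists2 k, k \in K & k \in FSym X /\ k != 1.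
  (* The 3-cycle t = (b d e) moves b = f a but not a, so t and f do not commute. *)
  have [a fa] := neq1_moves f1; set b := f a in fa.
  have [d dl] := fresh infX [:: a; b]; have [e el] := fresh infX [:: d; a; b].
  move: dl el; rewrite !inE !negb_or => /andP[da db] /and3P[ed ea eb].
  have bde : uniq [:: b; d; e] by rewrite uniq3E ![b == _]eq_sym db eb eq_sym.
  have tA := cyc_FAlt bde; set t := cyc b d e in tA.
  exists (f^-1 * f ^ t); first exact: KR.
  split; first by rewrite RE gpredM ?FSymJ ?gpredVr //; case/andP: tA.
  apply: contra_neqN db => /eqP/mulg1_eq; rewrite invgK => fE.
  have ta : t a = a by rewrite cyc_out // !inE !negb_or ![a == _]eq_sym fa da.
  by have := conj_symE f t a; rewrite -fE ta -/b (cyc1 bde) => ->.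
have [a ka] := neq1_moves k1; set b := k a in ka.
have /FSymP[l kl] := kF; have [d dl] := fresh infX [:: k b, b & l].
have [e el] := fresh infX [:: d, k b, b & l].
move: dl el; rewrite !inE !negb_or => /and3P[dkb db dl] /and4P[ed ekb eb el].
have kbb : k b != b by rewrite (inj_eq (@sym_inj _ k)).
have bde : uniq [:: b; d; e] by rewrite uniq3E ![b == _]eq_sym db eb eq_sym.
have kbed : uniq [:: k b; e; d] by rewrite uniq3E ![k b == _]eq_sym dkb ekb.
have kbbd : uniq [:: k b; b; d] by rewrite uniq3E kbb ![_ == d]eq_sym dkb db.
(* Since k fixes d and e, the commutator is (k b, e, d)(b, d, e), two 3-cycles
   that overlap in d and e with opposite orientation. *)
have mE : k^-1 * k ^ cyc b d e = cyc (k b) b d.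
  rewrite RE cycV cycJ (kl e el) (kl d dl).
  have pE x : (cyc (k b) e d * cyc b d e) x = cyc b d e (cyc (k b) e d x) by [].
  apply: cyc_eq; rewrite ?pE // ?(cyc1 kbed) ?(cyc2 kbed) ?(cyc3 kbed)
     ?(cyc1 bde) ?(cyc2 bde) ?(cyc3 bde) //.
  - by rewrite (cyc_out kbed) ?(cyc1 bde) // !inE !negb_or ![b == _]eq_sym kbb eb.
  - by rewrite (cyc_out bde) // !inE !negb_or kbb ![k b == _]eq_sym dkb ekb.
  move=> x; rewrite !inE !negb_or => /and3P[xkb xb xd]; rewrite pE.
  have [->|xe] := eqVneq x e; first by rewrite (cyc2 kbed) (cyc2 bde).
  rewrite (cyc_out kbed) ?(cyc_out bde) // !inE !negb_or.
    by rewrite xb xe xd.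
  by rewrite xkb xe xd.
apply: FAlt_gen => x y z xyz.
have [g gA] := FAlt_transitive infX kbbd xyz erefl.
case=> <- <- <-; rewrite -cycJ -mE; apply: KJ => //; apply: KR => //.
exact: cyc_FAlt.
Qed.

(** If f moves x, a 3-cycle through x that fixes f x does not commute with f. *)
Lemma centralise_FAlt f : (forall t, t \in FAlt X -> t ^ f = t) -> f = 1.
Proof.
move=> fC; apply/eqP; apply: contraPT isT => /neq1_moves[x fx].
have [y] := fresh infX [:: x; f x]; have [z] := fresh infX [:: x; f x; y].
rewrite !inE !negb_or => /and3P[zx zfx zy] /andP[yx yfx].
have xyz : uniq [:: x; y; z] by rewrite uniq3E ![x == _]eq_sym yx zx eq_sym.
have := conj_symE (cyc x y z) f x; rewrite (fC _ (cyc_FAlt xyz)) (cyc1 xyz).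
rewrite cyc_out // => [/sym_inj xy|]; first by rewrite xy eqxx in yx.
by rewrite !inE !negb_or fx ![f x == _]eq_sym yfx zfx.
Qed.

Lemma conj_FAlt_inj f g : (forall t, t \in FAlt X -> t ^ f = t ^ g) -> f = g.
Proof.
move=> fg; apply: divg1_eq; apply: centralise_FAlt => t tA.
by rewrite conjgM fg // conjgK.
Qed.
End Monolith.

(** * Recognising 3-cycles by the orders of products *)

Section ThreeCycles.
Variable X : eqType.
Implicit Types (a b c d e x y z : X) (f g t s : Sym X) (u v l : seq X).

Lemma expg_iter f n x : (f ^+ n) x = iter n f x.
Proof. by elim: n => // n IHn; rewrite expgSr symM IHn. Qed.

(** Every orbit of f has at most [size l] points, by the pigeonhole principle
applied to the iterates of f at a point of [l]. *)
Lemma expg_small_support f l m : (forall x, x \notin l -> f x = x) ->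
  (forall d : nat, 0 < d <= size l -> d %| m) -> f ^+ m = 1.
Proof.
move=> fl dm; apply: Sym_ext => x; rewrite expg_iter sym1.
have [xl|xl] := boolP (x \in l); last by rewrite iter_fix // fl.
have il i : iter i f x \in l.
  elim: i => //= i; apply: contraTT => yl.
  by have /sym_inj yE := fl _ yl; rewrite yE in yl.
have : looping f x (size l).
  apply: contraT; rewrite -looping_uniq => xu.
  have /(uniq_leq_size xu) : {subset traject f x (size l).+1 <= l}.
    by move=> _ /trajectP[i _ ->].
  by rewrite size_traject ltnn.
case/trajectP => i il' xi; have /dvdnP[q ->] : size l - i %| m.
  by apply: dm; rewrite subn_gt0 il' leq_subr.
rewrite iterM iter_fix //.
by apply: (@sym_inj _ (f ^+ i)); rewrite !expg_iter -iterD subnKC 1?ltnW.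
Qed.

Lemma three_cycle_mul_exp60 t s : three_cycle t -> three_cycle s -> (t * s) ^+ 60 = 1.
Proof.
move=> [a [b [c [abc ->]]]] [a' [b' [c' [abc' ->]]]].
apply: (@expg_small_support _ ([:: a; b; c] ++ [:: a'; b'; c'])).
  by move=> x; rewrite mem_cat negb_or symM => /andP[xl xl']; rewrite !cyc_out.
by do 7!case=> //.
Qed.

Lemma three_cycle_neq1 t : three_cycle t -> t != 1.
Proof.
case=> a [b [c [abc ->]]]; apply: (@moves_neq1 _ _ a); rewrite (cyc1 abc).
by move: abc; rewrite uniq3E eq_sym => /andP[].
Qed.

Lemma three_cycle_exp3 t : three_cycle t -> t ^+ 3 = 1.
Proof. by move=> t3; apply: Sym_ext => x; rewrite expg_iter /= three_cycleK. Qed.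

Lemma orbit3_uniq t a : t ^+ 3 = 1 -> t a != a -> uniq [:: a; t a; t (t a)].
Proof.
move=> t1 ta; have ttt : t (t (t a)) = a by have := expg_iter t 3 a; rewrite t1 => /esym.
rewrite uniq3E !(inj_eq (@sym_inj _ t)) [a == t a]eq_sym ta andbT /=.
by apply: contraNneq ta => aE; rewrite -{2}ttt -aE.
Qed.

(** If t had two orbits {x1, x2, x3} and {x4, x5, x6} of size 3, it would have a
conjugate s acting on x1, ..., x6 and one more point x7 as the 3-cycle
(x3 x4 x7). Then t s has the orbit x1, x2, x4, x5, x6, x7, x3, whose size 7 does
not divide 60. *)
Lemma three_cycle_of_exp60 t : infinite_set [set: X]%classic ->
  t \in FSym X -> t ^+ 3 = 1 -> t != 1 ->
  (forall g, g \in FAlt X -> (t * t ^ g) ^+ 60 = 1) -> three_cycle t.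
Proof.
move=> infX tF t1 tn t60.
have ttt x : t (t (t x)) = x by have := expg_iter t 3 x; rewrite t1 => /esym.
have [x1 tx1] := neq1_moves tn.
have u1 := orbit3_uniq t1 tx1.
set x2 := t x1 in tx1 u1; set x3 := t x2 in u1.
have t3E : t x3 = x1 by exact: ttt.
have [[x4 /andP[x4l tx4]]|] := pselect
    (exists x, (x \notin [:: x1; x2; x3]) && (t x != x)); last first.
  move=> no; exists x1, x2, x3; split=> //; apply: cyc_eq => // x xl.
  by apply/eqP/negPn/negP => tx; apply: no; exists x; rewrite xl.
have u4 := orbit3_uniq t1 tx4.
set x5 := t x4 in tx4 u4; set x6 := t x5 in u4.
have t6E : t x6 = x4 by exact: ttt.
have tl x : t x \in [:: x1; x2; x3] -> x \in [:: x1; x2; x3].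
  rewrite !inE -{1}t3E -{1}/x2 -{1}/x3 !(inj_eq (@sym_inj _ t)).
  by case/or3P => ->; rewrite ?orbT.
have x5l : x5 \notin [:: x1; x2; x3] by apply: contra x4l => /tl.
have x6l : x6 \notin [:: x1; x2; x3] by apply: contra x5l => /tl.
have ux : uniq ([:: x1; x2; x3] ++ [:: x4; x5; x6]).
  by rewrite cat_uniq u1 u4 /= (negbTE x4l) (negbTE x5l) (negbTE x6l).
have /FSymP[l lt] := tF.
have [v [uv vE vl]] := fresh_seq infX 5 ([:: x1; x2; x3; x4; x5; x6] ++ l).
case: v vE uv vl => [|x7 [|y1 [|y2 [|y3 [|y4 [|? ?]]]]]] // _ uv vl.
have vt y : y \in [:: x7; y1; y2; y3; y4] -> t y = y.
  by move=> /vl; rewrite mem_cat negb_or => /andP[_ /lt].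
have vx y : y \in [:: x7; y1; y2; y3; y4] -> y \notin [:: x1; x2; x3; x4; x5; x6].
  by move=> /vl; rewrite mem_cat negb_or => /andP[].
have uu : uniq ([:: x1; x2; x3] ++ [:: y1; y2; y3; y4]).
  rewrite cat_uniq u1 (subseq_uniq _ uv) ?subseq_cons // andbT.
  apply/hasPn => y yv; apply: contra (vx y _); last by rewrite inE yv orbT.
  by rewrite !inE => /or3P[] ->; rewrite ?orbT.
have uw : uniq [:: x3; x4; x7; x1; x2; x5; x6].
  have x7l : x7 \notin [:: x1; x2; x3] ++ [:: x4; x5; x6] by apply: vx; rewrite mem_head.
  rewrite (uniq_catCA [:: x3; x4] [:: x7; x1; x2] [:: x5; x6]).
  by rewrite (cons_uniq x7) x7l.
(* g carries the cycle (x1 x2 x3) of t to (x3 x4 x7), and fixed points of t to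
   the points that s has to fix. *)
have [g gA] := FAlt_transitive infX uu uw erefl.
case=> g1 g2 g3 h1 h2 h3 h4.
pose s := t ^ g.
have sE x : s (g x) = g (t x) by exact: conj_symE.
have s3 : s x3 = x4 by rewrite -{1}g1 sE g2.
have s4 : s x4 = x7 by rewrite -{1}g2 sE g3.
have s7 : s x7 = x3 by rewrite -{1}g3 sE t3E g1.
have sfix y z : y \in [:: y1; y2; y3; y4] -> g y = z -> s z = z.
  by move=> yv <-; rewrite sE vt // inE yv orbT.
have s1 : s x1 = x1 by apply: sfix h1; rewrite !inE eqxx ?orbT.
have s2 : s x2 = x2 by apply: sfix h2; rewrite !inE eqxx ?orbT.
have s5 : s x5 = x5 by apply: sfix h3; rewrite !inE eqxx ?orbT.
have s6 : s x6 = x6 by apply: sfix h4; rewrite !inE eqxx ?orbT.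
have p1 : (t * s) x1 = x2 by rewrite symM -/x2 s2.
have p2 : (t * s) x2 = x4 by rewrite symM -/x3 s3.
have p4 : (t * s) x4 = x5 by rewrite symM -/x5 s5.
have p5 : (t * s) x5 = x6 by rewrite symM -/x6 s6.
have p6 : (t * s) x6 = x7 by rewrite symM t6E s4.
have p7 : (t * s) x7 = x3 by rewrite symM vt ?inE ?eqxx // s7.
have p3 : (t * s) x3 = x1 by rewrite symM t3E s1.
have := expg_iter (t * s) 60 x1; rewrite t60 // sym1.
have p77 : iter 7 (t * s) x1 = x1.
  by rewrite !iterS p1 p2 p4 p5 p6 p7 p3.
rewrite (_ : 60 = 4 + 8 * 7) // iterD iterM (iter_fix _ p77) !iterS p1 p2 p4 p5 => x16.
by rewrite -x16 !inE eqxx in x6l.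
Qed.
End ThreeCycles.

(** * Directed edges shared by 3-cycles *)

Section Edges.
Variable X : eqType.
Implicit Types (a b c d e x y z : X) (f g t s : Sym X) (u v l : seq X).

(** A 3-cycle is seen as a directed triangle with edges from x to its image. *)
Definition share_edge t s := exists2 a, t a != a & s a = t a.

Lemma three_cycle_edge_eq t s a : three_cycle t -> three_cycle s -> t a != a -> s a = t a ->
  s (s a) = t (t a) -> s = t.
Proof.
move=> t3 s3 ta sa ssa; have [_ ->] := three_cycle_at t3 ta.
by have [|_ ->] := three_cycle_at s3 (a := a); rewrite ?sa // -sa ssa sa.
Qed.

(** The product of (a b x) and (a b y) is (a y)(b x). Conversely, two triangles
without a common directed edge either are disjoint, share a single point, share
an edge with opposite directions, or are inverse to each other; in each case
the square of the product is not 1 or the product is 1. *)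
Lemma share_edgeP t s : three_cycle t -> three_cycle s -> t != s ->
  share_edge t s <-> (t * s) ^+ 2 = 1 /\ t * s != 1.
Proof.
move=> t3 s3 ts; split=> [[a ta sa]|[ts2 ts1]].
  set b := t a in ta sa; set x := t b; set y := s b.
  have [abx tE] : uniq [:: a; b; x] /\ t = cyc a b x by exact: three_cycle_at.
  have [aby sE] : uniq [:: a; b; y] /\ s = cyc a b y.
    by rewrite /y -sa; apply: three_cycle_at => //; rewrite sa.
  have xy : x != y by apply: contra_neq ts => xy; rewrite tE sE xy.
  have tx : t x = a by rewrite tE cyc3.
  have sy : s y = a by rewrite sE cyc3.
  have sx : s x = x.
    rewrite sE cyc_out // !inE !negb_or xy andbT; move: abx; rewrite uniq3E.
    by rewrite ![_ == x]eq_sym => /and3P[_ -> ->].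
  have ty : t y = y.
    rewrite tE cyc_out // !inE !negb_or [y == x]eq_sym xy andbT; move: aby; rewrite uniq3E.
    by rewrite ![_ == y]eq_sym => /and3P[_ -> ->].
  have pa : (t * s) a = y by rewrite symM -/b.
  have py : (t * s) y = a by rewrite symM ty.
  have pb : (t * s) b = x by rewrite symM -/x.
  have px : (t * s) x = b by rewrite symM tx.
  split.
    apply: Sym_ext => z; rewrite expg2 [LHS]symM sym1.
    have [->|za] := eqVneq z a; first by rewrite pa.
    have [->|zb] := eqVneq z b; first by rewrite pb.
    have [->|zx] := eqVneq z x; first by rewrite px.
    have [->|zy] := eqVneq z y; first by rewrite py.
    have pz : (t * s) z = z.
      have tz : t z = z by rewrite tE cyc_out // !inE !negb_or za zb zx.
      by rewrite symM tz sE cyc_out // !inE !negb_or za zb zy.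
    by rewrite !pz.
  apply: (@moves_neq1 _ _ a); rewrite pa.
  by rewrite eq_sym; move: aby; rewrite uniq3E => /and3P[].
apply: contrapT => no.
have H x : t x != x -> s x != t x.
  by move=> tx; apply/eqP => sx; apply: no; exists x.
have Q x : s (t (s (t x))) = x.
  by have := congr1 (fun f : Sym X => f x) ts2; rewrite expg2 => /=.
have tt x : t (t (t x)) = x by exact: three_cycleK.
have ss x : s (s (s x)) = x by exact: three_cycleK.
have [a ta] := neq1_moves (three_cycle_neq1 t3).
have tm x : (t (t x) != t x) = (t x != x) by rewrite (inj_eq (@sym_inj _ t)).
(* A point b moved by both: if there were none, t and s would commute and
   (t s)^2 would agree with t^2 on the support of t. *)
have [[b /andP[tb sb]]|dis] := pselect (exists b, (t b != b) && (s b != b)); last first.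
  have sfix x : t x != x -> s x = x.
    by move=> tx; apply/eqP/negPn/negP => sx; apply: dis; exists x; rewrite tx.
  have := Q a; rewrite (sfix (t a)) ?tm // (sfix (t (t a))) ?tm // => tta.
  by have := tt a; rewrite tta => taa; rewrite taa eqxx in ta.
(* a' is the preimage of b under t: the relation (t s)^2 = 1 read at a' links
   the edge of t into b with the edge of s out of b. *)
pose a' := t (t b); pose c := s b.
have ta' : t a' = b by exact: tt.
have tc : s (t c) = a' by have := Q a'; rewrite ta'.
have a'b : b != a' by rewrite -ta' !tm.
have [tcc|tcm] := eqVneq (t c) c.
  have sa' : s a' = b by rewrite -tc tcc; exact: ss.
  by have := H a'; rewrite ta' sa' eqxx => /(_ a'b).
have := three_cycle_moved t3 tb tcm; rewrite !inE => /or3P[] /eqP cE.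
- by move: sb; rewrite -[s b]/c cE eqxx.
- by move: (H b tb); rewrite -[s b]/c cE eqxx.
rewrite -/a' in cE; set x := t b in tb a'b.
have tx : t x = a' by [].
have sbE : s b = a' by [].
have [sx|sx] := eqVneq (s x) x.
  have := Q b; rewrite -/x sx tx => sa'.
  by have := H a'; rewrite ta' sa' eqxx => /(_ a'b).
have := three_cycle_moved s3 sb sx; rewrite !inE => /or3P[] /eqP xE.
- by rewrite xE eqxx in tb.
- by rewrite sbE in xE; move: (tm b); rewrite -/x tx xE eqxx -xE tb.
(* What remains is s = (b a' x), the inverse of t = (b x a'). *)
rewrite sbE in xE; case/eqP: ts1; apply: Sym_ext => z; rewrite symM sym1.
have [->|zb] := eqVneq z b; first by rewrite -/x xE -sbE ss.
have [->|zx] := eqVneq z x; first by rewrite tx -xE.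
have [->|za] := eqVneq z a'; first by rewrite ta'.
have tz : t z = z.
  apply/eqP/negPn/negP => /(three_cycle_moved t3 tb); rewrite -/x tx !inE.
  by rewrite (negbTE zb) (negbTE zx) (negbTE za).
rewrite tz; apply/eqP/negPn/negP => /(three_cycle_moved s3 sb); rewrite sbE -xE !inE.
by rewrite (negbTE zb) (negbTE zx) (negbTE za).
Qed.

(** For t1 = (a b x) and t2 = (a b y) the edges other than a -> b are b -> x and
x -> a, respectively b -> y and y -> a. As a, b, x and y are distinct, no
triangle contains one edge of each of these two pairs. *)
Lemma common_edge t1 t2 t3 a : three_cycle t1 -> three_cycle t2 -> three_cycle t3 ->
  t1 a != a -> t2 a = t1 a -> t1 != t2 -> share_edge t1 t3 -> share_edge t2 t3 ->
  t3 a = t1 a.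
Proof.
move=> c1 c2 c3; set b := t1 a => ab t2a t12 [u t1u t3u] [v t2v t3v].
set x := t1 b; set y := t2 b.
have xy : x != y.
  apply: contra_neq t12 => xy; apply/esym; apply: (three_cycle_edge_eq (a := a)) => //.
  by rewrite t2a -/y -xy.
have t2m : t2 a != a by rewrite t2a.
have t1x : t1 x = a by exact: three_cycleK.
have t2y : t2 y = a by rewrite /y -t2a; exact: three_cycleK.
have bx : x != b by rewrite /x /b (inj_eq (@sym_inj _ t1)).
have by_ : y != b by rewrite /y -t2a (inj_eq (@sym_inj _ t2)) t2a.
have ax : a != x by apply: contra ab => /eqP ax; rewrite /b {1}ax t1x.
have ay : a != y by apply: contra t2m => /eqP ay; rewrite {1}ay t2y.
have ub : u \in [:: a; b; x] by exact: three_cycle_moved.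
have vb : v \in [:: a; b; y] by rewrite /y -t2a; exact: three_cycle_moved.
move: ub vb; rewrite !inE => /or3P[] /eqP uE; [by move=> _; rewrite -uE t3u uE| |];
  move=> /or3P[] /eqP vE; try by rewrite -vE t3v vE t2a.
- by case/eqP: xy; rewrite /x -uE -t3u uE -vE t3v vE.
- have t3b : t3 b = x by rewrite -uE t3u uE.
  have t3y : t3 y = a by rewrite -vE t3v vE.
  have := three_cycle_moved (a := b) (x := y) c3; rewrite t3b t3y bx ay => /(_ isT isT).
  rewrite !inE (negbTE by_) eq_sym (negbTE xy) /= => /eqP yE.
  by move: ab; rewrite -t3y yE -t3b three_cycleK // eqxx.
- have t3x : t3 x = a by rewrite -uE t3u uE.
  have t3b : t3 b = y by rewrite -vE t3v vE.
  have := three_cycle_moved (a := b) (x := x) c3; rewrite t3b t3x by_ ax => /(_ isT isT).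
  rewrite !inE (negbTE bx) (negbTE xy) /= => /eqP xE.
  by move: ab; rewrite -t3x xE -t3b three_cycleK // eqxx.
- case/eqP: xy; apply: (@sym_inj _ t3).
  by rewrite -{1}uE t3u uE t1x -vE t3v vE t2y.
Qed.
End Edges.

(** * Automorphisms and characteristic subgroups *)

Section Automorphisms.
Variable gT : groupType.
Implicit Types (phi : Aut gT) (H M N : groupClosed gT) (x y : gT).

Lemma autM phi x y : subg_val phi (x * y) = subg_val phi x * subg_val phi y.
Proof. by have /asboolP := subg_valP phi; exact. Qed.

Lemma aut1 phi : subg_val phi 1 = 1.
Proof. by apply: (mulgI (subg_val phi 1)); rewrite -autM !mulg1. Qed.

Lemma autV phi x : subg_val phi x^-1 = (subg_val phi x)^-1.
Proof. by apply/esym/mulg1_eq; rewrite -autM mulgV aut1. Qed.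

Lemma autJ phi x y : subg_val phi (x ^ y) = subg_val phi x ^ subg_val phi y.
Proof. by rewrite !conjgE !autM autV. Qed.

Lemma autX phi x n : subg_val phi (x ^+ n) = subg_val phi x ^+ n.
Proof. by elim: n => [|n IHn]; rewrite ?aut1 // !expgS autM IHn. Qed.

Lemma autVK phi x : subg_val phi (subg_val phi^-1 x) = x.
Proof. exact: symKV. Qed.

Lemma autKV phi x : subg_val phi^-1 (subg_val phi x) = x.
Proof. exact: symVK. Qed.

Lemma characteristicW H :
  (forall phi x, x \in H -> subg_val phi x \in H) -> characteristic H.
Proof.
move=> Hphi phi; apply/seteqP; split=> [_ [x xH <-]|x xH]; first exact: Hphi.
by exists (subg_val phi^-1 x); [exact: Hphi|exact: autVK].
Qed.

Definition aut_preim phi H : {pred gT} := [pred x | subg_val phi x \in H].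

Fact aut_preim1 phi H : 1 \in aut_preim phi H.
Proof. by rewrite inE /= aut1 gpred1. Qed.
Fact aut_preimM phi H : mulg_closed (aut_preim phi H).
Proof. by move=> x y; rewrite !inE /= autM; exact: gpredM. Qed.
Fact aut_preimV phi H : invg_closed (aut_preim phi H).
Proof. by move=> x; rewrite !inE /= autV; exact: gpredVr. Qed.

HB.instance Definition _ phi H :=
  isMulClosed.Build gT (aut_preim phi H) (@aut_preimM phi H).
HB.instance Definition _ phi H :=
  isMul1Closed.Build gT (aut_preim phi H) (aut_preim1 phi H).
HB.instance Definition _ phi H :=
  isInvClosed.Build gT (aut_preim phi H) (@aut_preimV phi H).

(** The preimage of M under any automorphism is again normal and non-trivial, so it
contains M. *)
Lemma least_normal_characteristic M : normal M -> nontrivial M ->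
  (forall N, normal N -> nontrivial N -> {subset M <= N}) -> characteristic M.
Proof.
move=> Mn [m mM m1] Mmin; apply: characteristicW => phi x.
apply: (Mmin (aut_preim phi M)) => [y g|].
  by rewrite !inE /= autJ; exact: Mn.
exists (subg_val phi^-1 m); first by rewrite inE /= autVK.
by apply: contra_neq m1 => m1; rewrite -(autVK phi m) m1 aut1.
Qed.
End Automorphisms.

Section Image.
Variables (gT : groupType) (G : groupClosed gT) (N : groupClosed (subg G)).

Definition subg_image : {pred gT} :=
  [pred f | `[< exists2 x : subg G, x \in N & subg_val x = f >]].

Fact subg_image1 : 1 \in subg_image.
Proof. by apply/asboolP; exists 1; rewrite ?gpred1. Qed.
Fact subg_imageM : mulg_closed subg_image.
Proof.
move=> _ _ /asboolP[x xN <-] /asboolP[y yN <-]; apply/asboolP.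
by exists (x * y); rewrite ?gpredM.
Qed.
Fact subg_imageV : invg_closed subg_image.
Proof.
move=> _ /asboolP[x xN <-]; apply/asboolP.
by exists (x^-1); rewrite ?gpredVr.
Qed.
HB.instance Definition _ := isMulClosed.Build gT subg_image subg_imageM.
HB.instance Definition _ := isMul1Closed.Build gT subg_image subg_image1.
HB.instance Definition _ := isInvClosed.Build gT subg_image subg_imageV.
End Image.

(** * Automorphisms of a group of permutations containing FAlt(X) *)

Section Main.
Variables (X : eqType) (G : groupClosed (Sym X)).
Hypothesis infX : infinite_set [set: X]%classic.
Hypothesis FAltG : {subset FAlt X <= G}.
Implicit Types (a b x y z : X) (f r : Sym X) (g s t : subg G) (phi : Aut (subg G)).

Lemma FAlt_normal : normal (insubg (FAlt X) G).
Proof. by move=> x g; rewrite !inE; exact: FAltJ. Qed.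

Lemma FAlt_nontrivial : nontrivial (insubg (FAlt X) G).
Proof.
have [v [uv vE _]] := fresh_seq infX 3 [::].
case: v vE uv => [|a [|b [|c []]]] // _ abc.
have t3 : three_cycle (cyc a b c) by exists a, b, c.
exists (Subg (FAltG (three_cycle_FAlt t3))); first by rewrite inE; exact: three_cycle_FAlt.
by apply: contra_neq (three_cycle_neq1 t3) => /(congr1 (@subg_val _ _)).
Qed.

Lemma FAlt_least (N : groupClosed (subg G)) : normal N -> nontrivial N ->
  {subset insubg (FAlt X) G <= N}.
Proof.
move=> Nn [n nN n1] g; rewrite inE /= => gA.
have : subg_val g \in subg_image N.
  apply: (normal_ge_FAlt infX (K := subg_image N)) gA => [f t|].
    move=> /asboolP[h hN <-] tA; apply/asboolP.
    by exists (h ^ Subg (FAltG tA)) => //; exact: Nn.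
  exists (subg_val n); first by apply/asboolP; exists n.
  by apply: contra_neq n1 => n1; apply: val_inj.
by move=> /asboolP[h hN /val_inj <-].
Qed.

Lemma FAlt_characteristic : characteristic (insubg (FAlt X) G).
Proof.
exact: least_normal_characteristic FAlt_normal FAlt_nontrivial FAlt_least.
Qed.

Lemma subg_monolithic : monolithic (subg G).
Proof.
exists (insubg (FAlt X) G : groupClosed (subg G)).
by split; [exact: FAlt_normal|exact: FAlt_nontrivial|exact: FAlt_least].
Qed.

Lemma aut_FAlt phi g : subg_val g \in FAlt X -> subg_val (subg_val phi g) \in FAlt X.
Proof.
move=> gA.
have := congr1 (fun A : set (subg G) => A (subg_val phi g)) (FAlt_characteristic phi).
by move=> /= e; suff : (subg_val phi g \in insubg (FAlt X) G) by []; rewrite -e; exists g.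
Qed.

(** The criterion [three_cycle_of_exp60] mentions only FAlt(X), which is
characteristic, and the group operations of [G]. *)
Lemma aut_three_cycle phi t :
  three_cycle (subg_val t) -> three_cycle (subg_val (subg_val phi t)).
Proof.
move=> t3; have tA := three_cycle_FAlt t3.
have vX s n : subg_val (s ^+ n) = subg_val s ^+ n.
  by elim: n => // n IHn; rewrite !expgS -IHn.
apply: three_cycle_of_exp60 => //.
- by case/andP: (aut_FAlt phi tA).
- rewrite -vX -autX (_ : t ^+ 3 = 1) ?aut1 //.
  by apply: val_inj; exact: etrans (vX _ _) (three_cycle_exp3 t3).
- apply: contra_neq (three_cycle_neq1 t3) => p1.
  rewrite -(autKV phi t) (_ : subg_val phi t = 1) ?aut1 //; exact: val_inj.
move=> g gA; pose h := subg_val phi^-1 (Subg (FAltG gA)).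
have -> : g = subg_val (subg_val phi h) by rewrite autVK.
have : (t * t ^ h) ^+ 60 = 1.
  apply: val_inj; apply: (etrans (vX _ _)).
  exact: three_cycle_mul_exp60 t3 (three_cycleJ (subg_val h) t3).
by move=> /(congr1 (fun s => subg_val (subg_val phi s))); rewrite autX autM autJ aut1 vX.
Qed.

Lemma aut_share_edge phi s t :
  three_cycle (subg_val s) -> three_cycle (subg_val t) -> s != t ->
  share_edge (subg_val s) (subg_val t) ->
  share_edge (subg_val (subg_val phi s)) (subg_val (subg_val phi t)).
Proof.
move=> s3 t3 st; have vst g h : g != h -> subg_val g != subg_val h.
  by apply: contra_neq => /val_inj.
have pst : subg_val phi s != subg_val phi t by rewrite (inj_eq (@sym_inj _ _)).
move=> /(share_edgeP s3 t3 (vst _ _ st))[st2 st1].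
apply/(share_edgeP (aut_three_cycle phi s3) (aut_three_cycle phi t3) (vst _ _ pst)).
have st2' : (s * t) ^+ 2 = 1 by exact: val_inj.
split.
  have := congr1 (fun s => subg_val (subg_val phi s)) st2'.
  by rewrite autX autM aut1.
apply: contra_neq st1 => p1; have {}p1 : subg_val phi (s * t) = 1.
  by apply: val_inj; rewrite autM.
by rewrite -[RHS]/(subg_val (1 : subg G)) -(aut1 phi^-1) -p1 autKV.
Qed.

(** This is [common_edge] for the images of [t1], [t2] and [t], which share edges
because [t1], [t2] and [t] do. *)
Lemma aut_edge phi a b a' b' t1 t2 t :
  three_cycle (subg_val t1) -> three_cycle (subg_val t2) -> three_cycle (subg_val t) ->
  a != b -> a' != b' -> t1 != t2 -> subg_val t1 a = b -> subg_val t2 a = b ->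
  subg_val (subg_val phi t1) a' = b' -> subg_val (subg_val phi t2) a' = b' ->
  subg_val t a = b -> subg_val (subg_val phi t) a' = b'.
Proof.
move=> c1 c2 c ab ab' t12 t1a t2a p1 p2 ta.
have [->//|tt1] := eqVneq t t1; have [->//|tt2] := eqVneq t t2.
rewrite -p1; apply: (@common_edge _ _ (subg_val (subg_val phi t2))); rewrite ?p1 ?p2 //;
  try exact: aut_three_cycle.
- by rewrite eq_sym.
- by apply: contra_neq t12 => /val_inj/sym_inj.
- by apply: aut_share_edge; rewrite // 1?eq_sym //; exists a; rewrite t1a ?ta // eq_sym.
- by apply: aut_share_edge; rewrite // 1?eq_sym //; exists a; rewrite t2a ?ta // eq_sym.
Qed.

(** Conjugating (a b x) twice by (a b y) gives (y a x), so all 3-cycles through a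
are obtained; conjugating (a y z) by (a x w) moves a away and gives (x y z). *)
Lemma FAlt_star_gen (K : groupClosed (Sym X)) a b : a != b ->
  (forall x, uniq [:: a; b; x] -> cyc a b x \in K) -> {subset FAlt X <= K}.
Proof.
move=> ab Kab.
have KJ x y z f : f \in K -> cyc x y z \in K -> cyc (f x) (f y) (f z) \in K.
  by move=> fK cK; rewrite -cycJ gpredJ.
have Ka x y : uniq [:: a; x; y] -> cyc a x y \in K.
  rewrite uniq3E => /and3P[ax ay xy].
  have [bx|bx] := eqVneq b x.
    by rewrite -bx in xy *; apply: Kab; rewrite uniq3E ab ay xy.
  have [bY|bY] := eqVneq b y.
    by rewrite -bY in xy *; rewrite -cycV gpredVr // Kab // uniq3E ab ax eq_sym xy.
  have abx : uniq [:: a; b; x] by rewrite uniq3E ab ax bx.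
  have aby : uniq [:: a; b; y] by rewrite uniq3E ab ay bY.
  have yx : cyc a b y x = x.
    by rewrite cyc_out // !inE !negb_or xy ![x == _]eq_sym ax bx.
  have := KJ _ _ _ _ (Kab _ aby) (KJ _ _ _ _ (Kab _ aby) (Kab _ abx)).
  rewrite yx (cyc1 aby) (cyc2 aby) (cyc3 aby) yx => yax.
  by rewrite -cyc_rot // uniq3_rot uniq3E ax ay xy.
apply: FAlt_gen => x y z xyz.
have [ax|ax] := eqVneq a x; first by rewrite -ax in xyz *; exact: Ka.
have [ay|ay] := eqVneq a y.
  by rewrite cyc_rot //; rewrite uniq3_rot -ay in xyz *; exact: Ka.
have [az|az] := eqVneq a z.
  rewrite cyc_rot //; rewrite uniq3_rot in xyz; rewrite cyc_rot //.
  by rewrite uniq3_rot -az in xyz *; exact: Ka.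
have [w] := fresh infX [:: a; x; y; z]; rewrite !inE !negb_or => /and4P[wa wx wy wz].
move: xyz; rewrite uniq3E => /and3P[xy xz yz].
have axw : uniq [:: a; x; w] by rewrite uniq3E ax ![_ == w]eq_sym wa wx.
have := KJ _ _ _ _ (Ka _ _ axw) (Ka y z _); rewrite uniq3E ay az yz (cyc1 axw).
rewrite ![cyc a x w _](cyc_out axw) ?inE ?negb_or; first exact.
  by rewrite ![z == _]eq_sym az xz wz.
by rewrite ![y == _]eq_sym ay xy wy.
Qed.

(** The equaliser of [phi] and conjugation by [r]. It is taken inside [Sym X] for
[FAlt_star_gen] to apply. *)
Definition conj_agree phi r : {pred Sym X} :=
  [pred f | `[< exists2 t : subg G, subg_val t = f & subg_val (subg_val phi t) = f ^ r >]].

Fact conj_agree1 phi r : 1 \in conj_agree phi r.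
Proof. by apply/asboolP; exists 1; rewrite // aut1 conj1g. Qed.
Fact conj_agreeM phi r : mulg_closed (conj_agree phi r).
Proof.
move=> _ _ /asboolP[s <- sE] /asboolP[t <- tE]; apply/asboolP; exists (s * t) => //.
by rewrite autM conjMg -sE -tE.
Qed.
Fact conj_agreeV phi r : invg_closed (conj_agree phi r).
Proof.
move=> _ /asboolP[s <- sE]; apply/asboolP; exists (s^-1) => //.
by rewrite autV conjVg -sE.
Qed.
HB.instance Definition _ phi r :=
  isMulClosed.Build (Sym X) (conj_agree phi r) (@conj_agreeM phi r).
HB.instance Definition _ phi r :=
  isMul1Closed.Build (Sym X) (conj_agree phi r) (conj_agree1 phi r).
HB.instance Definition _ phi r :=
  isInvClosed.Build (Sym X) (conj_agree phi r) (@conj_agreeV phi r).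

(** A total function of the three points, so that one of them can vary freely in
[aut_agree_FAlt]. *)
Definition cycG a b x : subg G := insubd (1 : subg G) (cyc a b x).

Lemma cycGE a b x : uniq [:: a; b; x] -> subg_val (cycG a b x) = cyc a b x.
Proof. by move=> /cyc_FAlt/FAltG; exact: (@insubdK _ _ (subg G)). Qed.

Lemma cycG_three_cycle a b x : uniq [:: a; b; x] -> three_cycle (subg_val (cycG a b x)).
Proof. by move=> abx; rewrite cycGE //; exact: cyc_three_cycle. Qed.

(** The images of the 3-cycles (a b x) share an edge from a' to b', and the third
vertex of the image of (a b x) is the image of x under the permutation [r]
sought. Surjectivity of [r] is [aut_edge] for the inverse of [phi]. *)
Lemma aut_agree_FAlt phi : exists r, {subset FAlt X <= conj_agree phi r}.
Proof.
have [v [uv vE _]] := fresh_seq infX 4 [::].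
case: v vE uv => [|a [|b [|x0 [|x1 []]]]] // _ abxx.
have ab : a != b by move: abxx => /=; rewrite inE negb_or => /andP[/andP[]].
have x01 : x0 != x1 by move: abxx; rewrite /= !inE => /and4P[].
have ab0 : uniq [:: a; b; x0] by apply: subseq_uniq abxx; rewrite /= !eqxx.
have ab1 : uniq [:: a; b; x1].
  by apply: subseq_uniq abxx; rewrite /= !eqxx eq_sym (negbTE x01) eqxx.
have cyc01 : cycG a b x0 != cycG a b x1.
  apply: contra_neq x01 => /(congr1 (fun t => subg_val t b)).
  by rewrite !cycGE // (cyc2 ab0) (cyc2 ab1).
have := aut_share_edge phi (cycG_three_cycle ab0) (cycG_three_cycle ab1) cyc01.
case; first by exists a; rewrite !cycGE // !cyc1 // eq_sym.
set p := fun x => subg_val (subg_val phi (cycG a b x)).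
rewrite -/(p x0) -/(p x1) => a'.
set b' := p x0 a' => a'b' p1a'.
have pa' x : uniq [:: a; b; x] -> p x a' = b'.
  move=> abx; apply: (aut_edge (t1 := cycG a b x0) (t2 := cycG a b x1) (a := a) (b := b));
    rewrite ?cycGE // ?cyc1 //; try exact: cyc_three_cycle.
  by rewrite eq_sym.
have pE x : uniq [:: a; b; x] -> uniq [:: a'; b'; p x b'] /\ p x = cyc a' b' (p x b').
  move=> abx; have /three_cycle_at : three_cycle (p x).
    exact/aut_three_cycle/cycG_three_cycle.
  by move=> /(_ a'); rewrite (pa' x abx); exact.
have pbx x : uniq [:: a; b; x] -> p x b' != a' /\ p x b' != b'.
  by move=> /pE[]; rewrite uniq3E ![_ == p x b']eq_sym => /and3P[].
have abP x : x != a -> x != b -> uniq [:: a; b; x].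
  by rewrite uniq3E ab ![x == _]eq_sym => -> ->.
pose r x := if x == a then a' else if x == b then b' else p x b'.
have ra : r a = a' by rewrite /r eqxx.
have rb : r b = b' by rewrite /r eq_sym (negbTE ab) eqxx.
have rx x : uniq [:: a; b; x] -> r x = p x b'.
  by rewrite uniq3E /r ![_ == x]eq_sym => /and3P[_ /negbTE-> /negbTE->].
have r_inj : injective r.
  move=> x y; have [->|xa] := eqVneq x a.
    rewrite ra; have [->//|ya] := eqVneq y a; have [->|yb] := eqVneq y b.
      by rewrite rb => e; rewrite -e eqxx in a'b'.
    rewrite rx ?abP // => e; have [] := pbx _ (abP _ ya yb).
    by rewrite -e eqxx.
  have [->|xb] := eqVneq x b.
    rewrite rb; have [->|ya] := eqVneq y a.
      by rewrite ra => e; rewrite -e eqxx in a'b'.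
    have [->//|yb] := eqVneq y b.
    rewrite rx ?abP // => e; have [_] := pbx _ (abP _ ya yb).
    by rewrite -e eqxx.
  rewrite (rx x) ?abP //.
  have [->|ya] := eqVneq y a; first
    by rewrite ra => e; have [] := pbx _ (abP _ xa xb); rewrite e eqxx.
  have [->|yb] := eqVneq y b; first
    by rewrite rb => e; have [_] := pbx _ (abP _ xa xb); rewrite e eqxx.
  rewrite rx ?abP // => e.
  have : p x = p y.
    by have [_ ->] := pE _ (abP _ xa xb); have [_ ->] := pE _ (abP _ ya yb); rewrite e.
  move=> /val_inj/sym_inj/(congr1 (fun t => subg_val t b)).
  by rewrite !cycGE ?abP // !cyc2 ?abP.
have r_surj y : exists x, r x = y.
  have [->|ya] := eqVneq y a'; first by exists a.
  have [->|yb] := eqVneq y b'; first by exists b.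
  have a'b'y : uniq [:: a'; b'; y] by rewrite uniq3E ![_ == y]eq_sym ya yb eq_sym a'b'.
  set T := subg_val phi^-1 (cycG a' b' y).
  have T3 : three_cycle (subg_val T) by exact/aut_three_cycle/cycG_three_cycle.
  have Ta : subg_val T a = b.
    apply: (aut_edge (t1 := subg_val phi (cycG a b x0)) (t2 := subg_val phi (cycG a b x1))
      (a := a') (b := b')); rewrite ?autKV ?cycGE // ?cyc1 // ?(inj_eq (@sym_inj _ _)) //;
      try (by apply: aut_three_cycle; exact: cycG_three_cycle); try exact: cyc_three_cycle.
    by rewrite eq_sym.
  have [] := @three_cycle_at _ _ a T3; first by rewrite Ta eq_sym.
  rewrite Ta => abT TE; exists (subg_val T b); rewrite rx // /p.
  have -> : cycG a b (subg_val T b) = T by apply: val_inj; rewrite /= cycGE.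
  by rewrite autVK cycGE // cyc2.
have [q qK] := choice r_surj.
have rK : cancel r q by move=> x; apply: r_inj; rewrite qK.
exists (MkSym rK qK); apply: (FAlt_star_gen ab) => x abx.
apply/asboolP; exists (cycG a b x); first exact: cycGE.
by rewrite cycJ /= ra rb rx //; have [_] := pE _ abx.
Qed.

(** For t in FAlt(X), applying phi to the conjugate of t by g shows that [phi g] and
[g ^ r] conjugate t^r in the same way, and t^r ranges over FAlt(X). *)
Lemma aut_conj phi : exists r, forall g, subg_val (subg_val phi g) = subg_val g ^ r.
Proof.
have [r rE] := aut_agree_FAlt phi; exists r => g.
have {}rE t : subg_val t \in FAlt X -> subg_val (subg_val phi t) = subg_val t ^ r.
  by move=> /rE/asboolP[s /val_inj ->].
apply: (conj_FAlt_inj infX) => s sA.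
have tA : s ^ r^-1 \in FAlt X by exact: FAltJ.
pose t : subg G := Subg (FAltG tA).
have tr : subg_val t ^ r = s by rewrite /= conjgKV.
have tg : subg_val (t ^ g) \in FAlt X by exact: FAltJ.
have := rE _ tg; rewrite autJ.
by rewrite [subg_val (t ^ g)]/(subg_val t ^ subg_val g) conjJg tr => <-; rewrite -{1}tr -rE.
Qed.

Lemma aut_FSym phi g :
  subg_val g \in FSym X -> subg_val (subg_val phi g) \in FSym X.
Proof. by have [r ->] := aut_conj phi; exact: FSymJ. Qed.

Lemma FSym_characteristic : characteristic (insubg (FSym X) G).
Proof. by apply: characteristicW => phi g; exact: aut_FSym. Qed.

Fact conj_subg_closed (r : subg (normaliser G)) g : subg_val g ^ subg_val r \in G.
Proof. by have /normaliserP -> := subg_valP r; exact: subg_valP. Qed.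

Definition conj_subg (r : subg (normaliser G)) g : subg G := Subg (conj_subg_closed r g).

Fact conj_subgK (r : subg (normaliser G)) : cancel (conj_subg r) (conj_subg r^-1).
Proof. by move=> g; apply: val_inj; exact: conjgK. Qed.

Fact conj_subgKV (r : subg (normaliser G)) : cancel (conj_subg r^-1) (conj_subg r).
Proof. by move=> g; apply: val_inj; exact: conjgKV. Qed.

Fact conj_subg_multiplicative (r : subg (normaliser G)) :
  MkSym (@conj_subgK r) (@conj_subgKV r) \in @multiplicative_pred (subg G).
Proof. by apply/asboolP => g h; apply: val_inj; exact: conjMg. Qed.

Definition conj_aut (r : subg (normaliser G)) : Aut (subg G) :=
  Subg (conj_subg_multiplicative r).

(** The permutation that induces an automorphism is unique because FAlt(X) has
trivial centraliser; uniqueness makes the choice of it a homomorphism. *)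
Lemma Aut_isomorphic_normaliser : isomorphic (Aut (subg G)) (subg (normaliser G)).
Proof.
have normE phi : exists r : subg (normaliser G),
    forall g, subg_val (subg_val phi g) = subg_val g ^ subg_val r.
  have [r rE] := aut_conj phi.
  suff rN : r \in normaliser G by exists (Subg rN).
  apply/normaliserP => f; apply/idP/idP => [frG|fG].
    have := rE (subg_val phi^-1 (Subg frG)); rewrite autVK => /conjg_inj ->.
    exact: subg_valP.
  by have <- := rE (Subg fG); exact: subg_valP.
have [F FE] := choice normE.
have F_uniq phi (r : subg (normaliser G)) :
    (forall g, subg_val (subg_val phi g) = subg_val g ^ subg_val r) -> F phi = r.
  move=> rE; apply: val_inj; apply: (conj_FAlt_inj infX) => s sA.
  by rewrite -(FE phi (Subg (FAltG sA))) rE.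
exists F.
  exists conj_aut => [phi|r]; last exact: F_uniq.
  by apply: val_inj; apply: Sym_ext => g; apply: val_inj; exact: esym (FE phi g).
move=> phi psi; apply: F_uniq => g.
by rewrite [RHS]conjgM -FE -FE.
Qed.

End Main.

(** * Conjugation and cycle type *)

Section CycleType.
Variable X : Type.
Implicit Types (f r : Sym X).

Lemma sym_orbitJ f r x : sym_orbit (f ^ r) (r x) = (r @` sym_orbit f x)%classic.
Proof.
have cE h y : (h ^ r) (r y) = r (h y) by rewrite conjgE !symM symVK.
apply/seteqP; split=> [y [n]|_ [y [n yE] <-]].
  rewrite -conjXg -conjVg !cE => -[<-|<-].
    by exists ((f ^+ n) x) => //; exists n; left.
  by exists ((f ^- n) x) => //; exists n; right.
by exists n; rewrite -conjXg -conjVg !cE; case: yE => <-; [left|right].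
Qed.

Lemma same_cycle_typeJ f r : same_cycle_type f (f ^ r).
Proof.
move=> S; have r_inj : injective r by exact: can_inj (sym_funK r).
have im_inj : injective (fun A : set X => r @` A)%classic.
  move=> A B /= AB; apply/funext => x.
  by rewrite -(image_inj (f := r) (A := A)) // AB image_inj.
have cardE (O : set X) : (r @` O #= S)%classic%card = (O #= S)%card.
  by apply: card_eql; apply: inj_card_eq => x y _ _; exact: r_inj.
have -> : [set O | sym_orbits (f ^ r) O /\ O #= S]%classic%card
    = ((fun A => r @` A) @` [set O | sym_orbits f O /\ O #= S])%classic%card.
  apply/seteqP; split=> [_ [[y _ <-] yS]|_ [_ [[x _ <-] xS] <-]].
    have yE : sym_orbit (f ^ r) y = (r @` sym_orbit f (r^-1 y))%classic.
      by rewrite -sym_orbitJ symKV.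
    exists (sym_orbit f (r^-1 y)); last by rewrite yE.
    by split; [exists (r^-1 y)|rewrite -cardE -yE].
  by split; [exists (r x); rewrite // sym_orbitJ|rewrite /= cardE].
by rewrite card_eq_sym; apply: inj_card_eq => A B _ _; exact: im_inj.
Qed.
End CycleType.

(** * The structure of Aut(G) *)

Theorem proposition1 (X : Type) (G : groupClosed (Sym X))
    (infX : infinite_set [set: X]%classic)
    (FAltG : {subset FAlt X <= G}) :
  characteristic (insubg (FAlt X) G) /\
  isomorphic (Aut (subg G)) (subg (normaliser G)) /\
  monolithic (subg G) /\
  (forall (phi : Aut (subg G)) (g : subg G),
     same_cycle_type (subg_val g) (subg_val (subg_val phi g))) /\
  ({subset FSym X <= G} -> characteristic (insubg (FSym X) G)).
Proof.
(* Classically every type has decidable equality. *)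
pose Y : eqType := {classic X}.
split; first exact: (@FAlt_characteristic Y G infX FAltG).
split; first exact: (@Aut_isomorphic_normaliser Y G infX FAltG).
split; first exact: (@subg_monolithic Y G infX FAltG).
split=> [phi g|_]; last exact: (@FSym_characteristic Y G infX FAltG).
have [r rE] := @aut_conj Y G infX FAltG phi; rewrite rE.
exact: same_cycle_typeJ.
Qed.
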